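(* Let $n\ge1$. Let $\langle\vec{2}_{2n\times 2n}\rangle$ be the cyclic subgroup of the sandpile group $\mathcal{S}(\mathrm{S}\Gamma_{2n\times 2n})$ generated by the all-$2$s element $\vec 2_{2n\times2n}$ (two grains of sand on each non-sink vertex) of the sandpile grid graph $\mathrm{S}\Gamma_{2n\times 2n}$, and let $\vec{2}_{n}$ denote the all-$2$s element on the sandpile graph $P_n$. Then the mapping $\psi\colon\langle\vec{2}_{2n\times 2n}\rangle\to\mathcal{S}(P_n)$ determined by $\psi(\vec{2}_{2n\times 2n})=\vec{2}_n$ is a well-defined injective homomorphism of groups.
   Context: For a finite connected undirected multigraph (edge weights = edge multiplicities $\mathrm{wt}(u,v)=\mathrm{wt}(v,u)\in\mathbb{N}$) with a distinguished sink vertex $s$ and non-sink vertex set $\widetilde V$, the reduced Laplacian is the $\mathbb{Z}$-linear map $\widetilde\Delta\colon\mathbb{Z}\widetilde V\to\mathbb{Z}\widetilde V$, $\widetilde\Delta(v)=\deg(v)\,v-\sum_{w\in\widetilde V}\mathrm{wt}(v,w)\,w$, where $\deg(v)$ counts all edges at $v$ including those to $s$. The sandpile group $\mathcal{S}$ is identified with $\mathbb{Z}\widetilde V/\mathrm{image}(\widetilde\Delta)$, and an element of $\mathbb{Z}\widetilde V$ is regarded as an element of the sandpile group via its class. The sandpile grid graph $\mathrm{S}\Gamma_{p\times q}$ has non-sink vertices $[p]\times[q]$, an edge of weight $1$ between $(a,b)$ and $(a',b')$ whenever $|a-a'|+|b-b'|=1$, and edges from grid vertices to the sink $s$ with weights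 chosen so that every non-sink vertex has total degree $4$. The sandpile graph $P_n$ has vertices $\{v_{i,j}:1\leq i\leq n,\ 1\leq j \leq i\}\cup\{s\}$ with sink $s$. Vertices $v_{i,j}$ and $v_{i',j'}$ are joined by an edge of weight $1$ when $|i-i'|+|j-j'|=1$, and every vertex of the form $v_{n,j}$ ($1\le j\le n$) is joined to $s$ by an edge of weight $1$; there are no other edges. *)

(* Defs.v *)
From HB Require Import structures.
From mathcomp Require Import all_boot all_order all_algebra.
From mathcomp Require Import boolp zify.

Set Implicit Arguments.
Unset Strict Implicit.
Unset Printing Implicit Defensive.

Import GRing.Theory IntDist.

Local Open Scope ring_scope.

(* The vertex set is [option nonsink], with [None] as the sink. *)
Record sandpile_graph := SandpileGraph {
  nonsink : finType;
  wt : option nonsink -> option nonsink -> nat;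
  wt_sym : forall u v, wt u v = wt v u;
  wt_connected : forall u v, connect [rel x y | (0 < wt x y)%N] u v
}.

Section SandpileGroup.
Variable G : sandpile_graph.
Local Notation V := (nonsink G).

Definition deg (v : V) : nat := (\sum_(u : option V) wt (Some v) u)%N.

Definition config := {ffun V -> int}.

HB.instance Definition _ := GRing.Zmodule.on config.

Definition vertex (v : V) : config := [ffun w => (w == v)%:Z].

Definition laplacian_vertex (v : V) : config :=
  vertex v *+ deg v - \sum_(w : V) vertex w *+ wt (Some v) (Some w).

Definition laplacian (c : config) : config :=
  \sum_(v : V) laplacian_vertex v *~ c v.

Lemma laplacian_is_zmod_morphism : zmod_morphism laplacian.
Proof.
move=> c d; rewrite /laplacian -sumrB; apply: eq_bigr => v _.
by rewrite !ffunE mulrzBr.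
Qed.

Definition laplacian_image : {pred config} := fun c =>
  `[< exists d : config, c = laplacian d >].

Lemma laplacian_image_zmod_closed : zmod_closed laplacian_image.
Proof.
split=> [|c d /asboolP [c' ->] /asboolP [d' ->]]; apply/asboolP.
  exists 0; have := laplacian_is_zmod_morphism 0 0.
  by rewrite !subrr.
by exists (c' - d'); rewrite laplacian_is_zmod_morphism.
Qed.

HB.instance Definition _ := GRing.isZmodClosed.Build config laplacian_image
  laplacian_image_zmod_closed.

Definition sandpile_group : zmodType := Quotient.quot laplacian_image.

Definition sandpile_class (c : config) : sandpile_group :=
  (\pi_(Quotient.quot laplacian_image) c)%qT.

Lemma sandpile_classP (c d : config) :
  sandpile_class c = sandpile_class d <->
  exists e : config, c - d = laplacian e.
Proof.
split=> [/eqP | h].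
  by rewrite -Quotient.idealrBE => /asboolP.
by apply/eqP; rewrite -Quotient.idealrBE; apply/asboolP.
Qed.

Lemma sandpile_class_is_zmod_morphism : zmod_morphism sandpile_class.
Proof. exact: raddfB. Qed.

HB.instance Definition _ := GRing.isZmodMorphism.Build config sandpile_group
  sandpile_class sandpile_class_is_zmod_morphism.

Definition all_twos : sandpile_group := sandpile_class [ffun=> 2%:Z].

End SandpileGroup.

Section CyclicSubgroup.
Variables (A : zmodType) (g : A).

Definition multiple_of : {pred A} := fun x => `[< exists k : int, x = g *~ k >].

Lemma multiple_of_zmod_closed : zmod_closed multiple_of.
Proof.
split=> [|x y /asboolP [k ->] /asboolP [l ->]]; apply/asboolP.
  by exists 0; rewrite mulr0z.
by exists (k - l); rewrite mulrzBr.
Qed.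

HB.instance Definition _ := GRing.isZmodClosed.Build A multiple_of
  multiple_of_zmod_closed.

Record cyclic_subgroup := CyclicSubgroup {
  cyclic_val :> A;
  cyclic_valP : cyclic_val \in multiple_of
}.

HB.instance Definition _ := [isSub for cyclic_val].
HB.instance Definition _ := [Choice of cyclic_subgroup by <:].
HB.instance Definition _ := [SubChoice_isSubZmodule of cyclic_subgroup by <:].

Lemma generator_subproof : g \in multiple_of.
Proof. by apply/asboolP; exists 1; rewrite mulr1z. Qed.

Definition generator : cyclic_subgroup := CyclicSubgroup generator_subproof.

End CyclicSubgroup.

Section AttachSink.
Variables (V : finType) (e : V -> V -> nat) (s : V -> nat).

Definition attach_sink (u v : option V) : nat :=
  match u, v with
  | Some x, Some y => e x y
  | Some x, None | None, Some x => s x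
  | None, None => 0
  end.

Hypothesis e_sym : forall x y, e x y = e y x.

Lemma attach_sink_sym u v : attach_sink u v = attach_sink v u.
Proof. by case: u v => [x|] [y|] /=. Qed.

Lemma attach_sink_connected :
    (forall x, connect [rel u v | (0 < attach_sink u v)%N] (Some x) None) ->
  forall u v, connect [rel u v | (0 < attach_sink u v)%N] u v.
Proof.
move=> to_sink u v; set r := [rel _ _ | _].
have r_sym : symmetric r by move=> x y; rewrite /r /= attach_sink_sym.
have to_None w : connect r w None by case: w.
apply: connect_trans (to_None u) _.
by rewrite (sym_connect_sym r_sym).
Qed.

End AttachSink.

Definition lattice_adj (x y : nat * nat) : bool :=
  (`|x.1 - y.1| + `|x.2 - y.2| == 1)%N.

Lemma lattice_adj_sym x y : lattice_adj x y = lattice_adj y x.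
Proof. by rewrite /lattice_adj distnC [X in (_ + X)%N]distnC. Qed.

(* The coordinates of both families of graphs start at 0 instead of 1. *)

Section GridGraph.
Variables p q : nat.
Local Notation V := ('I_p * 'I_q)%type.

Definition grid_wt (x y : V) : nat :=
  lattice_adj (nat_of_ord x.1, nat_of_ord x.2)
              (nat_of_ord y.1, nat_of_ord y.2).

Definition grid_sink_wt (x : V) : nat := (4 - \sum_(y : V) grid_wt x y)%N.

Lemma grid_wt_sym x y : grid_wt x y = grid_wt y x.
Proof. by rewrite /grid_wt lattice_adj_sym. Qed.

Lemma grid_neighbours_le (x : V) (s : seq (nat * nat)) :
    (forall y : V, (0 < grid_wt x y)%N -> (val y.1, val y.2) \in s) ->
  (\sum_(y : V) grid_wt x y <= size s)%N.
Proof.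
move=> hs; pose f (y : V) := (val y.1, val y.2).
have f_inj : injective f.
  by move=> [a b] [a' b'] [] /val_inj -> /val_inj ->.
have -> : (\sum_(y : V) grid_wt x y =
           #|[set y : V | lattice_adj (f x) (f y)]|)%N.
  rewrite -sum1dep_card [RHS]big_mkcond; apply: eq_bigr => y _.
  by rewrite /grid_wt /f; case: (lattice_adj _ _).
rewrite cardE -(size_map f); apply: uniq_leq_size.
  by rewrite map_inj_uniq ?enum_uniq.
move=> _ /mapP [y + ->]; rewrite mem_enum inE => xy.
by apply: hs; rewrite /grid_wt lt0b.
Qed.

Lemma grid_neighbours_le4 (x : V) : (\sum_(y : V) grid_wt x y <= 4)%N.
Proof.
apply: (@grid_neighbours_le x
  [:: ((val x.1).-1, val x.2); ((val x.1).+1, val x.2);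
      (val x.1, (val x.2).-1); (val x.1, (val x.2).+1)]) => -[a b] /=.
rewrite /grid_wt lt0b /lattice_adj /= !inE !xpair_eqE; lia.
Qed.

Lemma grid_sink_wt_gt0 (x : V) : val x.1 = 0%N -> (0 < grid_sink_wt x)%N.
Proof.
move=> x0; rewrite /grid_sink_wt subn_gt0 ltnS.
apply: (@grid_neighbours_le x
  [:: (1, val x.2); (0, (val x.2).-1); (0, (val x.2).+1)]%N) => -[a b] /=.
move: x0; rewrite /grid_wt lt0b /lattice_adj /= !inE !xpair_eqE; lia.
Qed.

Lemma grid_connect_sink (x : V) :
  connect [rel u v | (0 < attach_sink grid_wt grid_sink_wt u v)%N]
    (Some x) None.
Proof.
case: x => -[a a_lt] b; elim: a a_lt => [|a IH] a_lt.
  by apply: connect1; rewrite /= grid_sink_wt_gt0.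
apply: connect_trans (IH (ltnW a_lt)); apply: connect1.
by rewrite /= /grid_wt lt0b /lattice_adj /=; lia.
Qed.

Definition grid_graph : sandpile_graph :=
  SandpileGraph (attach_sink_sym grid_sink_wt grid_wt_sym)
    (attach_sink_connected grid_wt_sym grid_connect_sink).

Lemma deg_grid_graph (x : nonsink grid_graph) : deg x = 4%N.
Proof.
rewrite /deg (bigD1 None) //= (reindex_omap Some id) /=; last by case.
rewrite (eq_bigl xpredT); last by move=> y; rewrite eqxx.
by rewrite subnK // grid_neighbours_le4.
Qed.

End GridGraph.

Section TriangularGraph.
Variable n : nat.
Local Notation V := {x : 'I_n * 'I_n | (x.2 <= x.1)%N}.

Definition tri_wt (x y : V) : nat :=
  lattice_adj (nat_of_ord (val x).1, nat_of_ord (val x).2)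
              (nat_of_ord (val y).1, nat_of_ord (val y).2).

Definition tri_sink_wt (x : V) : nat := ((val x).1.+1 == n).

Lemma tri_wt_sym x y : tri_wt x y = tri_wt y x.
Proof. by rewrite /tri_wt lattice_adj_sym. Qed.

Lemma tri_connect_sink (x : V) :
  connect [rel u v | (0 < attach_sink tri_wt tri_sink_wt u v)%N]
    (Some x) None.
Proof.
move dE : (n - (val x).1)%N => d.
elim: d x dE => [|d IH] [[a b] /= ba] /= dE; first by have := ltn_ord a; lia.
have [an|an] := eqVneq a.+1 n.
  by apply: connect1; rewrite /= /tri_sink_wt /= an eqxx.
have a_lt : (a.+1 < n)%N by have := ltn_ord a; lia.
pose y : V := exist _ (Ordinal a_lt, b) (leqW ba).
apply: (@connect_trans _ _ (Some y)); last by apply: IH => /=; lia.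
by apply: connect1; rewrite /= /tri_wt lt0b /lattice_adj /=; lia.
Qed.

Definition tri_graph : sandpile_graph :=
  SandpileGraph (attach_sink_sym tri_sink_wt tri_wt_sym)
    (attach_sink_connected tri_wt_sym tri_connect_sink).

End TriangularGraph.

(* Main.v *)
Require Import Defs.
From HB Require Import structures.
From mathcomp Require Import all_boot all_order all_algebra.
From mathcomp Require Import boolp zify.
Import Order.TTheory GRing.Theory Num.Theory.
Local Open Scope ring_scope.

Set Implicit Arguments.
Unset Strict Implicit.

(* By the maximum principle the reduced Laplacian is injective, so any [f] on
   the grid whose Laplacian is constant inherits the dihedral symmetry of the
   square and is the unfolding of a function [F] on the triangle [P_n], the
   fundamental domain.  The grid Laplacian of such an [f] is the Laplacian of
   [F] off the diagonal and twice it on the diagonal.  Hence [k] times the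
   all-[2]s element vanishes on the grid iff the function equal to [2k] off the
   diagonal and to [k] on it lies in the image of the Laplacian of [P_n].  The
   indicator function of the diagonal is itself in that image, being the
   Laplacian of [v_(i,j) |-> n + 1 - i], so this amounts to [k] times the
   all-[2]s element vanishing on [P_n]. *)

(** * The reduced Laplacian: maximum principle, injectivity, automorphisms *)

Section ReducedLaplacian.
Variable G : sandpile_graph.
Local Notation V := (nonsink G).
Implicit Types (c d : config G) (v : V).

(** The definition combines columns of the Laplacian matrix; symmetry of [wt] turns this into the
    row at [v]. *)
Lemma laplacian_deg c v :
  laplacian c v = c v *+ deg v - \sum_(w : V) c w *+ wt (Some v) (Some w).
Proof.
rewrite /laplacian sum_ffunE.
have lapv (w : V) : (laplacian_vertex w *~ c w) v =
    (c v *+ deg v) *+ (v == w) - c w *+ wt (Some v) (Some w).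
  rewrite ffunMzE /laplacian_vertex !ffunE ffunMnE sum_ffunE (bigD1 v) //=.
  rewrite big1 => [|x xv]; last first.
    by rewrite ffunMnE ffunE eq_sym (negPf xv) mul0rn.
  rewrite ffunMnE !ffunE eqxx addr0 mulrzBl wt_sym.
  case: eqVneq => [->|_] /=; first by rewrite mulr1n mulrzz; lia.
  by rewrite mulr0n mul0rn mul0rz !sub0r mulrzz mulrnAl mul1r.
rewrite (eq_bigr _ (fun w _ => lapv w)) sumrB; congr (_ - _).
rewrite (bigD1 v) //= eqxx big1 ?addr0 // => w.
by rewrite eq_sym => /negPf ->.
Qed.

Lemma laplacian_diff c v :
  laplacian c v =
    \sum_(u : option V) (c v - oapp c 0 u) *+ wt (Some v) u.
Proof.
rewrite laplacian_deg /deg -sumrMnr.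
under [RHS]eq_bigr do rewrite mulrnBl.
rewrite sumrB; congr (_ - _).
rewrite [RHS](bigD1 None) //= mul0rn add0r [RHS](reindex_omap Some id) /=.
  by apply: eq_bigl => w; rewrite eqxx.
by case.
Qed.

(* Maximum principle: the vertices where [c], extended by [0] to the sink,
   is maximal form a set closed under adjacency. *)
Lemma laplacian_eq0_le0 c : laplacian c = 0 -> forall v, c v <= 0.
Proof.
move=> c0; pose e := oapp (c : V -> int) 0.
pose m := [arg max_(i > None | true) e i]%O.
have e_le u : e u <= e m.
  by rewrite /m; case: arg_maxP => // i _; apply.
suff em0 : e m = 0 by move=> v; have := e_le (Some v); rewrite em0.
(* At a non-sink maximum the vanishing Laplacian is a sum of nonnegative terms, so every neighbour
   is a maximum too; at the sink [e] is 0. *)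
have step x y : e x = e m -> (0 < wt x y)%N -> e x = 0 \/ e y = e m.
  case: x => [x|]; last by left.
  move=> xm xy; right; have /ffunP/(_ x) := c0.
  rewrite laplacian_diff ffunE.
  have ge0 u : true -> 0 <= (c x - oapp c 0 u) *+ wt (Some x) u.
    by rewrite mulrn_wge0 // subr_ge0 -[c x]/(e (Some x)) xm e_le.
  move/(psumr_eq0P ge0)/(_ y isT)/eqP.
  rewrite mulrn_eq0 eqn0Ngt xy /= subr_eq0 -xm => /eqP cxy.
  exact: esym cxy.
have /connectP [p] := wt_connected (s := G) m None.
have : e m = e m by [].
(* The start of the path is generalized to any [x] where the maximum is attained. *)
move: {1 3 4}m => x xm; elim: p x xm => [|y p IH] x xm /=.
  by move=> _ xN; rewrite -xm -xN.
case/andP => xy py yN; case: (step _ _ xm xy) => [x0|ym].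
  by rewrite -xm.
exact: IH ym py yN.
Qed.

Lemma laplacianN c : laplacian (- c) = - laplacian c.
Proof.
have := laplacian_is_zmod_morphism 0 c.
have -> : laplacian (0 : config G) = 0.
  by have := laplacian_is_zmod_morphism (0 : config G) 0; rewrite !subrr.
by rewrite !sub0r.
Qed.

(** The maximum principle applies to both [c - d] and its opposite. *)
Lemma laplacian_inj : injective (@laplacian G).
Proof.
move=> c d cd; have cd0 : laplacian (c - d) = 0.
  by rewrite laplacian_is_zmod_morphism cd subrr.
have dc0 : laplacian (- (c - d)) = 0 by rewrite laplacianN cd0 oppr0.
apply/ffunP => v.
have := laplacian_eq0_le0 cd0 v; have := laplacian_eq0_le0 dc0 v.
rewrite !ffunE oppr_le0 subr_ge0 subr_le0 => dc cd_v.
by apply: le_anti; rewrite dc cd_v.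
Qed.

Lemma laplacian_automorphism (sigma : V -> V) c v :
    injective sigma -> (forall x, deg (sigma x) = deg x) ->
    (forall x y, wt (Some (sigma x)) (Some (sigma y)) = wt (Some x) (Some y)) ->
  laplacian [ffun x => c (sigma x)] v = laplacian c (sigma v).
Proof.
move=> sI sdeg swt; rewrite !laplacian_deg ffunE sdeg; congr (_ - _).
rewrite [RHS](reindex_inj sI) /=.
by apply: eq_bigr => w _; rewrite ffunE swt.
Qed.

Lemma all_twosMz_eq0 (k : int) :
  all_twos G *~ k = 0 <-> exists c, forall v, laplacian c v = 2 * k.
Proof.
rewrite /all_twos -raddfMz -(raddf0 (@sandpile_class G)); split.
  case/sandpile_classP => c h; exists c => v.
  by rewrite -h subr0 ffunMzE ffunE mulrzz.
case=> c h; apply/sandpile_classP; exists c; apply/ffunP => v.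
by rewrite h subr0 ffunMzE ffunE mulrzz.
Qed.

End ReducedLaplacian.

(** * Sums over lattice neighbours, with extension by zero *)

Section LatticeSums.
Variables p q : nat.
Implicit Types f : 'I_p * 'I_q -> int.

Definition pad f (a b : nat) : int :=
  if insub a is Some i then if insub b is Some j then f (i, j) else 0 else 0.

Lemma pad_val f (x : 'I_p * 'I_q) : pad f x.1 x.2 = f x.
Proof. by case: x => i j; rewrite /pad !valK. Qed.

Lemma pad_ord f (a b : nat) (ap : (a < p)%N) (bq : (b < q)%N) :
  pad f a b = f (Ordinal ap, Ordinal bq).
Proof. by rewrite -pad_val. Qed.

Lemma pad_out f (a b : nat) : (p <= a)%N || (q <= b)%N -> pad f a b = 0.
Proof.
rewrite /pad; case: insubP => [i ip _|_ _]; last by [].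
by case: insubP => [j jq _|_ _]; first lia.
Qed.

Lemma sum_pad f (a b : nat) :
  \sum_(y : 'I_p * 'I_q) f y *+ ((val y.1 == a) && (val y.2 == b)) = pad f a b.
Proof.
have [/andP [ap bq]|out] := boolP ((a < p) && (b < q))%N; last first.
  rewrite pad_out; last lia.
  rewrite big1 // => -[[i ip] [j jq]] _ /=.
  by case: andP => // -[/eqP ia /eqP jb]; lia.
rewrite (pad_ord _ ap bq) (bigD1 (Ordinal ap, Ordinal bq)) //= !eqxx big1 ?addr0 //.
move=> [i j]; rewrite xpair_eqE -!val_eqE /= => /negPf ->; exact: mulr0n.
Qed.

(** Since [0.-1 = 0], neighbours below 0 need explicit guards; those past the upper bounds vanish
    through [pad]. *)
Lemma sum_lattice_adj f (a b : nat) :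
  \sum_(y : 'I_p * 'I_q) f y *+ lattice_adj (a, b) (val y.1, val y.2) =
    (if (0 < a)%N then pad f a.-1 b else 0) + pad f a.+1 b +
    (if (0 < b)%N then pad f a b.-1 else 0) + pad f a b.+1.
Proof.
have adjE (i j : nat) : lattice_adj (a, b) (i, j) =
    (((i == a.-1) && (j == b)) * (0 < a) + ((i == a.+1) && (j == b)) +
     ((i == a) && (j == b.-1)) * (0 < b) + ((i == a) && (j == b.+1)))%N :> nat.
  rewrite /lattice_adj /=; case: (ltngtP i a) (ltngtP j b) => ? [] ?; lia.
under eq_bigr do rewrite adjE !mulrnDr !mulrnA.
rewrite !big_split /= !sumrMnl !sum_pad.
by do 2!case: ifP => _.
Qed.

End LatticeSums.

(** * The Laplacian of the triangle in coordinates *)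

Section Folding.
Variable n : nat.
Local Notation N := (2 * n)%N.
Local Notation grid := (grid_graph N N).
Local Notation tri := (tri_graph n).

Definition tri_pad (F : config tri) : nat -> nat -> int :=
  pad (fun y : 'I_n * 'I_n => oapp (F : nonsink tri -> int) 0 (insub y)).

Lemma tri_pad_val (F : config tri) (v : nonsink tri) :
  tri_pad F (val v).1 (val v).2 = F v.
Proof. by rewrite /tri_pad pad_val valK. Qed.

Lemma tri_pad_out (F : config tri) (i j : nat) :
  (n <= i)%N || (i < j)%N -> tri_pad F i j = 0.
Proof.
move=> ij; rewrite /tri_pad.
have [i_n|i_n] := leqP n i; first by rewrite pad_out ?i_n.
have [j_n|j_n] := leqP n j; first by rewrite pad_out ?j_n ?orbT.
by rewrite (pad_ord _ i_n j_n) insubF //=; lia.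
Qed.

(* An edge to the sink is an edge to a vertex in row [n], where [tri_pad]
   vanishes. *)
Lemma laplacian_tri (F : config tri) (v : nonsink tri)
    (i := val (val v).1) (j := val (val v).2) (T := tri_pad F) :
  laplacian F v =
    (if (j < i)%N then (T i j - T i.-1 j) + (T i j - T i j.+1) else 0) +
    (T i j - T i.+1 j) + (if (0 < j)%N then T i j - T i j.-1 else 0).
Proof.
rewrite laplacian_diff (bigD1 None) //= subr0.
rewrite [X in _ + X](reindex_omap Some id) /=; last by case.
under eq_bigl do rewrite eqxx.
(* The differences, rather than the values of [F], are extended by zero: lattice neighbours outside
   the triangle must contribute nothing. *)
pose K w := F v - F w.
pose K' (y : 'I_n * 'I_n) := oapp K 0 (insub y).
have -> : \sum_w (F v - F w) *+ tri_wt v w =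
    \sum_y K' y *+ lattice_adj (i, j) (val y.1, val y.2).
  rewrite [RHS](bigID (fun y : 'I_n * 'I_n => (y.2 <= y.1)%N)) /=.
  rewrite [X in _ + X]big1 ?addr0 => [|y /negPf yF]; last first.
    by rewrite /K' insubF //= mul0rn.
  rewrite (big_sub (fun y : 'I_n * 'I_n => (y.2 <= y.1)%N)).
  by apply: eq_bigr => w _; rewrite /K' valK.
rewrite sum_lattice_adj.
have padK a b : pad K' a b = if (a < n)%N && (b <= a)%N then T i j - T a b else 0.
  rewrite /T tri_pad_val /tri_pad.
  case: ifP => [/andP [an ba]|out].
    have bn := leq_ltn_trans ba an.
    by rewrite !(pad_ord _ an bn) /K' insubT.
  have [an|an] := leqP n a; first by rewrite pad_out ?an.
  have [bn|bn] := leqP n b; first by rewrite pad_out ?bn ?orbT.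
  by rewrite (pad_ord _ an bn) /K' insubF //=; lia.
rewrite !padK /tri_sink_wt -(tri_pad_val F v) -/i -/j -/T.
have Tn : T n j = 0 by apply: tri_pad_out; rewrite leqnn.
have ji : (j <= i)%N by exact: (valP v).
have i_n : (i < n)%N by exact: ltn_ord.
clearbody T i j.
have -> : (i.+1 == n) = ~~ (i.+1 < n)%N by lia.
have -> : (i.-1 < n)%N by lia.
rewrite i_n leqW // (leq_trans (leq_pred j)) //=.
have -> : (j <= i.-1)%N = (j < i)%N || (i == 0)%N by lia.
have T0 : (n <= i.+1)%N -> T i.+1 j = 0.
  by move=> n_i; have <- : n = i.+1 by lia.
have [_|/T0 ->] := ltnP i.+1 n; rewrite ?mulr0n ?mulr1n /=;
  (have [j_i|i_j] := ltnP j i;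
     [have -> /= : (0 < i)%N by lia | have -> : i = j by lia]);
  case: (j) => [|?] /=; lia.
Qed.

(** * Folding the grid onto the triangle *)

(* The two central rows of the grid have fold coordinate [0]. *)
Definition fold_coord (a : nat) : nat :=
  if (a < n)%N then (n - a.+1)%N else (a - n)%N.

Lemma fold_coord_lt (a : 'I_N) : (fold_coord a < n)%N.
Proof. by rewrite /fold_coord; have := ltn_ord a; case: ifP; lia. Qed.

(** Representative of the dihedral orbit of [x]: both coordinates are folded at the centre, then put
    in order. *)
Definition fold_pair (x : 'I_N * 'I_N) : 'I_n * 'I_n :=
  let i := Ordinal (fold_coord_lt x.1) in
  let j := Ordinal (fold_coord_lt x.2) in
  if (j <= i)%N then (i, j) else (j, i).

Lemma fold_pairP x : ((fold_pair x).2 <= (fold_pair x).1)%N.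
Proof. by rewrite /fold_pair; case: ifP => //=; lia. Qed.

Definition fold_vertex (x : nonsink grid) : nonsink tri :=
  exist _ (fold_pair x) (fold_pairP x).

Definition unfold (F : config tri) : config grid := [ffun x => F (fold_vertex x)].

(** The extension of [F] to a whole quadrant by reflection in the diagonal. *)
Definition sym_pad (F : config tri) (i j : nat) : int :=
  tri_pad F (maxn i j) (minn i j).

Lemma sym_padC F i j : sym_pad F i j = sym_pad F j i.
Proof. by rewrite /sym_pad maxnC minnC. Qed.

Lemma sym_pad_fold F (x : 'I_N * 'I_N) :
  sym_pad F (fold_coord x.1) (fold_coord x.2) = F (fold_vertex x).
Proof.
rewrite -tri_pad_val /sym_pad /= /fold_pair.
by case: ifP => /= h; congr tri_pad; lia.
Qed.

Lemma sym_pad_out F i j : (n <= i)%N || (n <= j)%N -> sym_pad F i j = 0.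
Proof. by move=> h; apply: tri_pad_out; lia. Qed.

(** Beyond the grid, [fold_coord] takes values at least [n], so both sides vanish there. *)
Lemma pad_unfold F (a b : nat) :
  pad (unfold F) a b = sym_pad F (fold_coord a) (fold_coord b).
Proof.
have out (c : nat) : (N <= c)%N -> (n <= fold_coord c)%N.
  by rewrite /fold_coord; case: ifP; lia.
have [aN|aN] := leqP N a.
  by rewrite sym_pad_out ?(out _ aN) // pad_out ?aN.
have [bN|bN] := leqP N b.
  by rewrite sym_pad_out ?(out _ bN) ?orbT // pad_out ?bN ?orbT.
by rewrite (pad_ord _ aN bN) ffunE -sym_pad_fold.
Qed.

(** At the centre one neighbour again folds to 0, which agrees with [0.-1 = 0]. At [a = 0] the
    missing neighbour is accounted for by [phi n = 0]. *)
Lemma sum_fold_coord (phi : nat -> int) (a : 'I_N) : phi n = 0 ->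
  (if (0 < a)%N then phi (fold_coord a.-1) else 0) + phi (fold_coord a.+1) =
    phi (fold_coord a).-1 + phi (fold_coord a).+1.
Proof.
have := ltn_ord a; case: a => a /= _ aN phin.
have [a0|a0] := posnP a.
  have -> : fold_coord a.+1 = (fold_coord a).-1.
    by rewrite /fold_coord; do !case: ifP; lia.
  have -> : (fold_coord a).+1 = n by rewrite /fold_coord; do !case: ifP; lia.
  by rewrite phin addrC.
have [an|an] := ltnP a n.
  rewrite addrC; congr (phi _ + phi _); rewrite /fold_coord; do !case: ifP; lia.
congr (phi _ + phi _); rewrite /fold_coord; do !case: ifP; lia.
Qed.

Lemma laplacian_grid (f : config grid) (x : nonsink grid) :
  laplacian f x = f x *+ 4 -
    ((if (0 < x.1)%N then pad f x.1.-1 x.2 else 0) + pad f x.1.+1 x.2 +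
     (if (0 < x.2)%N then pad f x.1 x.2.-1 else 0) + pad f x.1 x.2.+1).
Proof. by rewrite laplacian_deg deg_grid_graph /= -sum_lattice_adj. Qed.

(** Off the diagonal, the neighbours of [x] fold onto those of its image, except that one across a
    central line may fold onto the image itself and give difference 0. On the diagonal they fold in
    pairs, so every difference counts twice. *)
Lemma laplacian_unfold F (x : nonsink grid) :
  laplacian (unfold F) x =
    laplacian F (fold_vertex x) *+ (fold_coord x.1 == fold_coord x.2).+1.
Proof.
rewrite laplacian_grid laplacian_tri ffunE -sym_pad_fold !pad_unfold.
set i := fold_coord x.1; set j := fold_coord x.2.
have out_l : sym_pad F n j = 0 by rewrite sym_pad_out ?leqnn.
have out_r : sym_pad F i n = 0 by rewrite sym_pad_out ?leqnn ?orbT.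
rewrite (@sum_fold_coord (fun c => sym_pad F c j)) // -[X in _ - X]addrA.
rewrite (@sum_fold_coord (sym_pad F i)) // {out_l out_r} -/i -/j.
have -> : val (val (fold_vertex x)).1 = maxn i j.
  by rewrite /= /fold_pair; case: ifP => /= h; rewrite -/i -/j in h *; lia.
have -> : val (val (fold_vertex x)).2 = minn i j.
  by rewrite /= /fold_pair; case: ifP => /= h; rewrite -/i -/j in h *; lia.
move: i j => i j.
(* Both sides are invariant under exchanging [i] and [j]. *)
wlog ji : i j / (j <= i)%N.
  move=> H; have [/H //|/H {}H] := orP (leq_total j i).
  rewrite (maxnC i) (minnC i) (eq_sym i) -H (sym_padC F i j).
  rewrite (sym_padC F i.-1) (sym_padC F i.+1).
  rewrite (sym_padC F i j.-1) (sym_padC F i j.+1); lia.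
rewrite /sym_pad; have [ij|ij] := eqVneq i j.
  subst j; rewrite !maxnn !minnn ltnn.
  have [-> ->] : maxn i.-1 i = i /\ minn i.-1 i = i.-1 by lia.
  have [-> ->] : maxn i.+1 i = i.+1 /\ minn i.+1 i = i by lia.
  have [-> ->] : maxn i i.-1 = i /\ minn i i.-1 = i.-1 by lia.
  have [-> ->] : maxn i i.+1 = i.+1 /\ minn i i.+1 = i by lia.
  case: i {ji} => [|i] /=; lia.
have lt_ji : (j < i)%N by lia.
have [-> ->] : maxn i j = i /\ minn i j = j by lia.
have [-> ->] : maxn i.-1 j = i.-1 /\ minn i.-1 j = j by lia.
have [-> ->] : maxn i.+1 j = i.+1 /\ minn i.+1 j = j by lia.
have [-> ->] : maxn i j.-1 = i /\ minn i j.-1 = j.-1 by lia.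
have [-> ->] : maxn i j.+1 = i /\ minn i j.+1 = j.+1 by lia.
rewrite lt_ji; case: j {ji ij lt_ji} => [|j] /=; lia.
Qed.

(** * Dihedral symmetry of grid functions with constant Laplacian *)

Lemma outer_coord_lt (i : 'I_n) : (n + i < N)%N.
Proof. by have := ltn_ord i; lia. Qed.

(* The triangle as the part [j <= i] of the bottom right quadrant. *)
Definition sect (v : nonsink tri) : nonsink grid :=
  (Ordinal (outer_coord_lt (val v).1), Ordinal (outer_coord_lt (val v).2)).

Lemma sectK : cancel sect fold_vertex.
Proof.
case=> -[i j] /= ji; apply/val_inj; rewrite /= /fold_pair /=.
have E (k : 'I_n) : fold_coord (n + k) = k by rewrite /fold_coord; case: ifP; lia.
have Eo (k : 'I_n) : Ordinal (fold_coord_lt (Ordinal (outer_coord_lt k))) = k.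
  by apply: val_inj; rewrite /= E.
by rewrite !Eo !E /= ji.
Qed.

(** Composing [f] with [sigma] gives the same constant Laplacian, so injectivity applies. *)
Lemma laplacian_grid_automorphism (sigma : 'I_N * 'I_N -> 'I_N * 'I_N)
    (f : config grid) (k : int) :
    injective sigma ->
    (forall x y, grid_wt (sigma x) (sigma y) = grid_wt x y) ->
  (forall x, laplacian f x = k) -> forall x, f (sigma x) = f x.
Proof.
move=> sI swt fk; suff : [ffun x => f (sigma x)] = f.
  by move=> fE x; rewrite -[in RHS]fE ffunE.
apply: (@laplacian_inj grid); apply/ffunP => v.
rewrite (laplacian_automorphism (G := grid)) ?fk // => x.
by rewrite !deg_grid_graph.
Qed.

Lemma laplacian_const_unfold (f : config grid) (k : int) :
  (forall x, laplacian f x = k) -> f = unfold [ffun v => f (sect v)].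
Proof.
move=> fk; pose rev1 (x : 'I_N * 'I_N) := (rev_ord x.1, x.2).
pose swap (x : 'I_N * 'I_N) := (x.2, x.1).
have f_rev1 x : f (rev1 x) = f x.
  apply: laplacian_grid_automorphism fk x => [|[a b] [a' b']].
    by apply: inv_inj => -[a b]; rewrite /rev1 /= rev_ordK.
  rewrite /grid_wt /lattice_adj /=; have := ltn_ord a; have := ltn_ord a'.
  by move=> a_lt a'_lt; congr (nat_of_bool (_ == _)); lia.
have f_swap x : f (swap x) = f x.
  apply: laplacian_grid_automorphism fk x => [|[a b] [a' b']].
    by apply: inv_inj => -[a b].
  by rewrite /grid_wt /lattice_adj /= addnC.
(* This reflection is the conjugate of [rev1] by [swap]. *)
have f_rev2 a b : f (a, rev_ord b) = f (a, b).
  by rewrite -f_swap -[RHS]f_swap -[RHS]f_rev1.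
(* [up] moves a coordinate into the half containing the image of [sect]. *)
pose up (a : 'I_N) := if (a < n)%N then rev_ord a else a.
have f_up x : f x = f (up x.1, up x.2).
  rewrite /up; case: x => a b /=; do 2!case: ifP => _.
  - exact: esym (etrans (f_rev2 _ _) (f_rev1 (a, b))).
  - exact: esym (f_rev1 (a, b)).
  - exact: esym (f_rev2 _ _).
  - by [].
have upE (a : 'I_N) : up a = Ordinal (outer_coord_lt (Ordinal (fold_coord_lt a))).
  apply: val_inj; rewrite /up /= /fold_coord.
  by have := ltn_ord a; case: ifP => /=; lia.
apply/ffunP => x; rewrite !ffunE f_up !upE /sect /= /fold_pair.
by case: ifP => // _; rewrite -f_swap.
Qed.

(** * Correction along the diagonal and comparison of orders *)

Definition pyramid : config tri := [ffun v => n%:Z - (val (val v).1)%:Z].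

Lemma tri_pad_pyramid (i j : nat) : (j <= i <= n)%N ->
  tri_pad pyramid i j = n%:Z - i%:Z.
Proof.
case/andP=> ji; rewrite leq_eqVlt => /predU1P [->|i_n].
  by rewrite tri_pad_out ?leqnn // subrr.
have j_n := leq_ltn_trans ji i_n.
by rewrite /tri_pad (pad_ord _ i_n j_n) insubT //= ffunE.
Qed.

(** The differences with the rows before and after cancel; a diagonal vertex has no neighbour in the
    row before, which leaves 1. *)
Lemma laplacian_pyramid (v : nonsink tri) :
  laplacian pyramid v = ((val v).1 == (val v).2 :> nat)%:Z.
Proof.
rewrite laplacian_tri; have ji := valP v; have i_n := ltn_ord (val v).1.
move: ji i_n; rewrite /=; move: (val (val v).1) (val (val v).2) => i j ji i_n.
do 2!case: ifP => ?; rewrite ?tri_pad_pyramid; lia.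
Qed.

Lemma laplacianB_pyramid (F : config tri) (k : int) v :
  laplacian (F - pyramid *~ k) v =
    laplacian F v - ((val v).1 == (val v).2 :> nat)%:Z * k.
Proof.
have -> : pyramid *~ k = [ffun v => pyramid v * k].
  by apply/ffunP => w; rewrite ffunMzE mulrzz [RHS]ffunE.
rewrite laplacian_is_zmod_morphism !ffunE -laplacian_pyramid; congr (_ - _).
rewrite !laplacian_deg ffunE mulrBl mulr_suml mulrnAl; congr (_ - _).
by apply: eq_bigr => w _; rewrite ffunE mulrnAl.
Qed.

Lemma fold_diag (x : nonsink grid) :
  (fold_coord x.1 == fold_coord x.2) =
  ((val (fold_vertex x)).1 == (val (fold_vertex x)).2 :> nat).
Proof. by rewrite /= /fold_pair; case: ifP => //= _; rewrite eq_sym. Qed.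

Lemma all_twos_grid_tri (k : int) :
  all_twos grid *~ k = 0 <-> all_twos tri *~ k = 0.
Proof.
rewrite !all_twosMz_eq0; split=> -[c ck].
  (* The restriction of [c] has Laplacian [2 * k] off the diagonal and [k] on it; the pyramid
     supplies the other [k]. *)
  exists ([ffun v => c (sect v)] - pyramid *~ (- k)) => v.
  have := ck (sect v); rewrite {1}(laplacian_const_unfold ck).
  rewrite laplacian_unfold laplacianB_pyramid fold_diag sectK.
  by case: eqVneq => _ /=; lia.
(* The pyramid lowers the diagonal value to [k], which unfolding doubles back. *)
exists (unfold (c - pyramid *~ k)) => x.
rewrite laplacian_unfold laplacianB_pyramid fold_diag ck.
by case: eqVneq => _ /=; lia.
Qed.

End Folding.

(** * Homomorphisms out of a cyclic subgroup *)

(** The forward implication makes the map well defined, the converse makes it injective. *)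
Lemma cyclic_subgroup_embedding (A B : zmodType) (g : A) (h : B) :
    (forall k : int, g *~ k = 0 <-> h *~ k = 0) ->
  exists psi : {additive cyclic_subgroup g -> B},
    [/\ psi (generator g) = h, injective psi
      & forall psi' : {additive cyclic_subgroup g -> B},
          psi' (generator g) = h -> psi' =1 psi].
Proof.
move=> gh.
have gh_eq k l : g *~ k = g *~ l <-> h *~ k = h *~ l.
  by split=> /eqP; rewrite -subr_eq0 -mulrzBr => /eqP /gh /eqP;
     rewrite mulrzBr subr_eq0 => /eqP.
have ex (x : cyclic_subgroup g) : exists k : int, \val x = g *~ k.
  by have /asboolP := cyclic_valP x.
(* An arbitrary choice of exponent; by [gh_eq] the value of [phi] does not depend on it. *)
pose e x := projT1 (cid (ex x)).
have eP x : \val x = g *~ e x := projT2 (cid (ex x)).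
pose phi x := h *~ e x.
have phi_add : zmod_morphism phi.
  move=> x y; rewrite /phi -mulrzBr; apply/gh_eq.
  by rewrite -eP mulrzBr -!eP raddfB.
pose phiA := GRing.isZmodMorphism.Build _ _ phi phi_add.
pose psi : {additive cyclic_subgroup g -> B} := HB.pack phi phiA.
have psi_gen : psi (generator g) = h.
  by rewrite -[RHS]mulr1z; apply/gh_eq; rewrite -eP mulr1z.
exists psi; split=> // [x y xy|psi' psi'_gen x].
  by apply: val_inj; rewrite !eP; apply/gh_eq.
have -> : x = generator g *~ e x.
  by apply: val_inj; rewrite raddfMz /= -eP.
by rewrite !raddfMz psi'_gen psi_gen.
Qed.

Theorem theorem5p5 (n : nat) (hn : (1 <= n)%N) :
  exists psi : {additive cyclic_subgroup (all_twos (grid_graph (2 * n)%N (2 * n)%N))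
                         -> sandpile_group (tri_graph n)},
    [/\ psi (generator (all_twos (grid_graph (2 * n)%N (2 * n)%N)))
          = all_twos (tri_graph n),
        injective psi
      & forall psi' : {additive
            cyclic_subgroup (all_twos (grid_graph (2 * n)%N (2 * n)%N))
            -> sandpile_group (tri_graph n)},
          psi' (generator (all_twos (grid_graph (2 * n)%N (2 * n)%N)))
            = all_twos (tri_graph n) ->
          psi' =1 psi].
Proof. exact: cyclic_subgroup_embedding (@all_twos_grid_tri n). Qed.
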